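(* Let $[b_1,b_2,\ldots,b_m]$ be an even continued fraction ($m\ge1$). Then the Jones polynomial $V_{[b_1,\ldots,b_m]}$ of the associated oriented 2-bridge link $C[b_1,\ldots,b_m]$ has degree $$\sum_{i=1}^m\max\left((-1)^{i+1}b_i+\frac{\operatorname{sign}(b_ib_{i-1})}{2}\ ,\ -\frac12\right),$$ where we use the convention $\operatorname{sign}(b_0)=1$ (so $\operatorname{sign}(b_1b_0)=\operatorname{sign}(b_1)$). Moreover, the sign of its leading term is equal to $(-1)^{m-\tau}$, where $\tau$ is the number of times the (consecutive) subsequence $+,+$ appears in the type sequence of $[b_1,\ldots,b_m]$.
   Context: An even continued fraction is $[b_1,\ldots,b_m]=b_1+1/(b_2+1/(\cdots+1/b_m))$ with all $b_i$ nonzero even integers. Its type sequence is $(\operatorname{sgn}(b_1),-\operatorname{sgn}(b_2),\ldots,(-1)^{m+1}\operatorname{sgn}(b_m))$. The link $C[b_1,\ldots,b_m]$ is the oriented 2-bridge link with Conway diagram consisting of $m$ successive 2-strand braids, the $i$-th having $|b_i|$ crossings; the diagram alternates from the $i$-th to the $(i+1)$-st braid iff $b_i,b_{i+1}$ have the same sign, and it is oriented so that all crossings of the $i$-th braid have sign $(-1)^{i+1}\operatorname{sgn}(b_i)$. Concretely: take four horizontal strands in positions $1,2,3,4$ and, from left to right, the braid $\sigma_2^{-b_1}\sigma_1^{b_2}\sigma_2^{-b_3}\cdots$ ($i$-th factor $\sigma_2^{-b_i}$ for $i$ odd, $\sigma_1^{b_i}$ for $i$ even), where $\sigma_j$ crosses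 the strands in positions $j,j+1$ by a crossing that is positive when both strands are oriented left to right. On the left join ends $1$–$2$ and $3$–$4$; on the right join $1$–$2$ and $3$–$4$ if $m$ is odd, and $2$–$3$ and $1$–$4$ (nested arcs) if $m$ is even. Since all $b_i$ are even the braid is pure; orient the strands with ends in positions $1,3$ left to right and those in positions $2,4$ right to left. Jones polynomial: $V(\text{unknot})=1$ and $t^{-1}V(L_+)-t\,V(L_-)+(t^{-1/2}-t^{1/2})V(L_0)=0$ for oriented links $L_+,L_-,L_0$ that agree except near one point, where they have a positive crossing, a negative crossing, and the oriented smoothing respectively. The degree of a Laurent polynomial in $t^{1/2}$ is the highest exponent of $t$ that appears, and the leading term is the term realizing the degree. *)

(* Defs.v *)
From mathcomp Require Import all_boot all_order all_algebra.

Set Implicit Arguments.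
Unset Strict Implicit.
Unset Printing Implicit Defensive.

Import Order.TTheory GRing.Theory Num.Theory.
Local Open Scope ring_scope.

(** * Oriented link diagrams

An oriented tangle diagram in general position with respect to the horizontal
coordinate is read from left to right as a word in three kinds of elementary
pieces.  Positions are numbered from 0 (the positions 1, 2, 3, ... of a braid
are 0, 1, 2, ... here), and [true] as an orientation means "left to right".

- [Open i o]: an arc opening to the right, whose two ends get positions [i]
  (oriented by [o]) and [i.+1] (oriented by [~~ o]);
- [Close i]: an arc joining the strands in positions [i] and [i.+1];
- [Cross i true] (resp. [Cross i false]): the strands in positions [i] and
  [i.+1] cross, as in the braid generator sigma_(i+1) (resp. its inverse); the
  generator is the crossing which is positive when both strands are oriented
  from left to right. *)

Inductive piece : Type :=
  | Open of nat & bool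
  | Close of nat
  | Cross of nat & bool.

Definition diagram := seq piece.

(* The orientations of the strands at a vertical section, by position. *)
Definition section := seq bool.

(* [None] if the piece does not fit: missing strands, or an arc joining two
   strands with incompatible orientations. *)
Definition act (p : piece) (s : section) : option section :=
  match p with
  | Open i o =>
      if (i <= size s)%N then Some (take i s ++ [:: o; ~~ o] ++ drop i s)
      else None
  | Close i =>
      if (i.+1 < size s)%N && (nth true s i != nth true s i.+1)
      then Some (take i s ++ drop i.+2 s) else None
  | Cross i _ =>
      if (i.+1 < size s)%N
      then Some (take i s ++ [:: nth true s i.+1; nth true s i] ++ drop i.+2 s)
      else None
  end.

Definition run (D : diagram) (s : section) : option section :=
  foldl (fun os p => obind (act p) os) (Some s) D.

Definition is_link (D : diagram) : Prop := run D [::] = Some [::].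

(** * Isotopy

Two words represent isotopic oriented links iff they are related by a sequence
of the following moves (Reidemeister's theorem for diagrams with a height
function, due to Freyd-Yetter and Turaev).  Crossings of both types are
allowed in each move; the remaining variants of the third Reidemeister move
follow with the help of the second one. *)

Definition ends_in (p : piece) : nat := if p is Open _ _ then 0 else 2.
Definition ends_out (p : piece) : nat := if p is Close _ then 0 else 2.

Definition position (p : piece) : nat :=
  match p with Open i _ => i | Close i => i | Cross i _ => i end.

Definition piece_at (p : piece) (k : nat) : piece :=
  match p with
  | Open _ o => Open k o
  | Close _ => Close k
  | Cross _ c => Cross k c
  end.

Inductive local_move : diagram -> diagram -> Prop :=
  (* Disjoint pieces [p] and [q], with [p] in the lower positions, slide past
     each other; [k] is the number of strands not involved in [p] that have a
     position lower than [q]. *)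
  | move_slide (p q : piece) (k : nat) of (position p <= k)%N :
      local_move [:: p; piece_at q (k + ends_out p)]
                 [:: piece_at q (k + ends_in p); p]
  | move_zigzag (i : nat) (o : bool) :
      local_move [:: Open i o; Close i.+1] [::]
  | move_zagzig (i : nat) (o : bool) :
      local_move [:: Open i.+1 o; Close i] [::]
  (* A strand slides across the extremity of an arc. *)
  | move_open (i : nat) (o c : bool) :
      local_move [:: Open i o; Cross i.+1 c] [:: Open i.+1 o; Cross i (~~ c)]
  | move_close (i : nat) (c : bool) :
      local_move [:: Cross i.+1 c; Close i] [:: Cross i (~~ c); Close i.+1]
  | move_R1_open (i : nat) (o c : bool) :
      local_move [:: Open i o; Cross i c] [:: Open i (~~ o)]
  | move_R1_close (i : nat) (c : bool) :
      local_move [:: Cross i c; Close i] [:: Close i]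
  | move_R2 (i : nat) (c : bool) :
      local_move [:: Cross i c; Cross i (~~ c)] [::]
  | move_R3 (i : nat) (c : bool) :
      local_move [:: Cross i c; Cross i.+1 c; Cross i c]
                 [:: Cross i.+1 c; Cross i c; Cross i.+1 c].

Inductive isotopic : diagram -> diagram -> Prop :=
  | isotopic_refl (D : diagram) of is_link D : isotopic D D
  | isotopic_sym (D E : diagram) of isotopic D E : isotopic E D
  | isotopic_trans (D E F : diagram) of isotopic D E & isotopic E F :
      isotopic D F
  | isotopic_move (u v x y : diagram) of
      is_link (u ++ x ++ v) & is_link (u ++ y ++ v) & local_move x y :
      isotopic (u ++ x ++ v) (u ++ y ++ v).

(** * Laurent polynomials in [t^(1/2)]

They are viewed inside the field of rational functions over the integers, the
indeterminate of which stands for [t^(1/2)]. *)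

Definition ratfun : fieldType := {fraction {poly int}}.

Definition sqrt_t : ratfun := tofrac 'X.
Definition t : ratfun := sqrt_t ^+ 2.

Definition is_laurent (f : ratfun) : Prop :=
  exists (p : {poly int}) (k : nat), f = tofrac p / sqrt_t ^+ k.

(* [f] is a nonzero Laurent polynomial in [t^(1/2)], with leading term
   [c t^d], where [d] is a half-integer. *)
Definition has_leading_term (f : ratfun) (d : rat) (c : int) : Prop :=
  exists (p : {poly int}) (k : nat),
    [/\ p != 0, f = tofrac p / sqrt_t ^+ k,
        d = ((size p).-1%:R - k%:R) / 2 & c = lead_coef p].

(** * The Jones polynomial *)

(* The oriented smoothing depends on whether the two strands run in the same
   horizontal direction; so does the sign of the crossing. *)
Inductive skein_triple : diagram -> diagram -> diagram -> Prop :=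
  | skein_parallel (u v : diagram) (i : nat) (s : section) of
      is_link (u ++ [:: Cross i true] ++ v) & run u [::] = Some s &
      nth true s i = nth true s i.+1 :
      skein_triple (u ++ [:: Cross i true] ++ v)
                   (u ++ [:: Cross i false] ++ v)
                   (u ++ v)
  | skein_antiparallel (u v : diagram) (i : nat) (s : section) of
      is_link (u ++ [:: Cross i true] ++ v) & run u [::] = Some s &
      nth true s i <> nth true s i.+1 :
      skein_triple (u ++ [:: Cross i false] ++ v)
                   (u ++ [:: Cross i true] ++ v)
                   (u ++ [:: Close i; Open i (nth true s i.+1)] ++ v).

Definition unknot : diagram := [:: Open 0 true; Close 0].

Record is_jones (V : diagram -> ratfun) : Prop := IsJones {
  jones_laurent : forall D, is_link D -> is_laurent (V D);
  jones_isotopy : forall D E, isotopic D E -> V D = V E;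
  jones_unknot : V unknot = 1;
  jones_skein : forall Lp Lm L0, skein_triple Lp Lm L0 ->
    t^-1 * V Lp - t * V Lm + (sqrt_t^-1 - sqrt_t) * V L0 = 0 }.

(** * 2-bridge links and even continued fractions *)

Definition even_continued_fraction (bs : seq int) : bool :=
  all (fun b : int => (b != 0) && (2 %| b)%Z) bs.

(* [braid j b] is sigma_(j+1)^b. *)
Definition braid (j : nat) (b : int) : diagram :=
  nseq `|b|%N (Cross j (0 < b)).

(* The braids of [b_(k+1), b_(k+2), ...], where [odd_next] tells whether [k+1]
   is odd. *)
Fixpoint braids (odd_next : bool) (bs : seq int) : diagram :=
  if bs is b :: bs' then
    (if odd_next then braid 1 (- b) else braid 0 b) ++ braids (~~ odd_next) bs'
  else [::].

Definition right_closure (m : nat) : diagram :=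
  if odd m then [:: Close 0; Close 0] else [:: Close 1; Close 0].

Definition two_bridge (bs : seq int) : diagram :=
  [:: Open 0 true; Open 2 true] ++ braids true bs ++ right_closure (size bs).

(* The coefficient [b_i], for [1 <= i <= size bs]; putting [b_0 = 1] implements
   the convention [sign b_0 = 1]. *)
Definition coef_at (bs : seq int) (i : nat) : int := nth 0 (1 :: bs) i.

Definition type_sequence (bs : seq int) : seq int :=
  [seq (-1) ^+ i.+1 * sgz (coef_at bs i) | i <- iota 1 (size bs)].

(* The number of occurrences, possibly overlapping, of two consecutive [+]. *)
Definition count_plus_plus (s : seq int) : nat :=
  count (fun xy : int * int => (xy.1 == 1) && (xy.2 == 1)) (zip s (behead s)).

Definition jones_degree (bs : seq int) : rat :=
  \sum_(1 <= i < (size bs).+1)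
    Num.max ((-1) ^+ i.+1 * (coef_at bs i)%:~R
               + (sgz (coef_at bs i * coef_at bs i.-1))%:~R / 2)
            (- (1 / 2)).

(* Main.v *)
(**
Let V_m be the polynomial of the link of [b_1, ..., b_m] and a = (-1)^(m+1) b_m.
Smoothing a crossing of the last braid, and erasing the remaining ones by the
first Reidemeister move, leaves the link of [b_1, ..., b_(m-1)]; with a = 0, the
braid before the last one untwists as well and the link is that of
[b_1, ..., b_(m-2)].  So the skein relation is an affine recursion in a, with
the solution
  V_m = t^a V_(m-2) - (1 - t^a) t^(1/2) / (1 + t) V_(m-1),
where V_0 = 1 and V_(-1) = - t^(1/2) - t^(-1/2) is the two-component unlink.
The two terms never have the same degree: the first one dominates iff a > 0 and
the previous type is - (the convention sign(b_0) = 1 is the type - for m = 0).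
The induction keeps track of deg V_m - deg V_(m-1), which is at least 3/2 when
the last type is +, and is -1/2, with opposite leading signs, when it is -.
*)
Require Import Defs.
From mathcomp Require Import all_boot all_order all_algebra.
From mathcomp Require Import zify ring lra.
Import Order.TTheory GRing.Theory Num.Theory.
Local Open Scope ring_scope.

(** * Sections of composed diagrams *)

Lemma run_cat D E s : run (D ++ E) s = obind (run E) (run D s).
Proof.
rewrite /run foldl_cat; case: (foldl _ _ D) => //=.
by elim: E.
Qed.

Lemma run_cons p D s : run (p :: D) s = obind (run D) (act p s).
Proof. exact: (run_cat [:: p] D s). Qed.

Lemma run_congr u v x y r s : run u r = Some s -> run x s = run y s ->
  run (u ++ x ++ v) r = run (u ++ y ++ v) r.
Proof. by move=> u_s xy_s; rewrite !run_cat u_s /= !run_cat xy_s. Qed.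

Lemma act_Open s1 s2 o :
  act (Open (size s1) o) (s1 ++ s2) = Some (s1 ++ [:: o, ~~ o & s2]).
Proof. by rewrite /= size_cat leq_addr take_size_cat ?drop_size_cat. Qed.

Lemma act_Cross s1 a b s2 c :
  act (Cross (size s1) c) (s1 ++ [:: a, b & s2]) = Some (s1 ++ [:: b, a & s2]).
Proof.
rewrite /= size_cat -addn2 leq_add2l /= take_size_cat //.
rewrite !nth_cat ltnn subnn ltnNge leqnSn subSnn /=.
by rewrite -[in drop _ _]addn2 drop_cat ltnNge leq_addr addKn /= drop0.
Qed.

Lemma act_Close s1 a b s2 :
  act (Close (size s1)) (s1 ++ [:: a, b & s2]) =
    if a != b then Some (s1 ++ s2) else None.
Proof.
rewrite /= size_cat -addn2 leq_add2l /= take_size_cat //.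
rewrite !nth_cat ltnn subnn ltnNge leqnSn subSnn /=.
by rewrite -[in drop _ _]addn2 drop_cat ltnNge leq_addr addKn /= drop0.
Qed.

(** Brings a section to the shape used by [act_Cross] and [act_Close]. *)
Lemma section_split (i : nat) (s : section) : (i.+1 < size s)%N ->
  exists s1 a b s2, s = s1 ++ [:: a, b & s2] /\ size s1 = i.
Proof.
move=> lt_is; exists (take i s), (nth true s i), (nth true s i.+1), (drop i.+2 s).
split; last by rewrite size_take ltnW.
by rewrite -!drop_nth ?cat_take_drop // ltnW.
Qed.

(** * Field identities behind the skein recursion *)

Lemma sqrt_t_neq0 : sqrt_t != 0.
Proof. by rewrite tofrac_eq0 polyX_eq0. Qed.

Lemma addt_neq0 : 1 + t != 0.
Proof.
rewrite /t /sqrt_t -rmorphXn -(rmorph1 (@tofrac _)) -rmorphD tofrac_eq0 /=.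
apply/eqP => /(congr1 (fun p => p.[0])); rewrite !hornerE => /eqP.
by rewrite ?mul0r ?addr0 oner_eq0.
Qed.

Lemma subt_neq0 : 1 - t != 0.
Proof.
rewrite /t /sqrt_t -rmorphXn -(rmorph1 (@tofrac _)) -rmorphB tofrac_eq0 /=.
apply/eqP => /(congr1 (fun p => p.[0])); rewrite !hornerE => /eqP.
by rewrite ?mul0r ?subr0 oner_eq0.
Qed.

Lemma skein_unlink (F : fieldType) (s x : F) : s != 0 -> 1 - s ^+ 2 != 0 ->
  (s ^+ 2)^-1 * 1 - s ^+ 2 * 1 + (s^-1 - s) * x = 0 -> x = - (s + s^-1).
Proof.
move=> s0 s1 skein; rewrite -[x]subr0 -(mulr0 (s / (1 - s ^+ 2))) -skein.
by field; rewrite s0 s1.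
Qed.

(** Solving for either side lets a braid grow by negative or by positive crossings. *)
Lemma skein_solve (F : fieldType) (s X W W' : F) : s != 0 ->
  (s ^+ 2)^-1 * W - s ^+ 2 * W' + (s^-1 - s) * X = 0 ->
  W' = (s ^+ 2) ^- 2 * W + (s ^+ 2)^-1 * (s^-1 - s) * X /\
  W = (s ^+ 2) ^+ 2 * W' - s ^+ 2 * (s^-1 - s) * X.
Proof.
move=> s0 skein; split.
  rewrite -[LHS]addr0 -(mulr0 (s ^+ 2)^-1) -{}skein.
  by field; rewrite s0.
rewrite -[LHS]subr0 -(mulr0 (s ^+ 2)) -{}skein.
by field; rewrite s0.
Qed.

(* The [V (P ++ right_closure m.+1)]-coefficient of the fixed point of the
   recursion [jones_braid]. *)
Definition limit_coef : ratfun := - sqrt_t / (1 + t).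

(** [k * X] is the fixed point of both affine maps, so a step only rescales the deviation
    [T * (Y - k * X)] from it. *)
Lemma braid_recursion (F : fieldType) (c : bool) (s T X Y : F)
    (k := - s / (1 + s ^+ 2)) (W := T * Y + (1 - T) * k * X)
    (T' := (if c then (s ^+ 2) ^- 2 else (s ^+ 2) ^+ 2) * T) :
    s != 0 -> 1 + s ^+ 2 != 0 ->
  (if c then (s ^+ 2) ^- 2 * W + (s ^+ 2)^-1 * (s^-1 - s) * X
   else (s ^+ 2) ^+ 2 * W - s ^+ 2 * (s^-1 - s) * X)
    = T' * Y + (1 - T') * k * X.
Proof. by rewrite /T' /W /k => s0 s1; case: c {T'}; field; rewrite s0 s1. Qed.

(** * Braids on four strands *)

(* The section at both ends of every braid of [two_bridge]. *)
Definition ends4 : section := [:: true; false; true; false].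

(** The [m]-th braid sits at position [odd m]; two crossings restore the orientations. *)
Lemma run_braid m n c : ~~ odd n ->
  run (nseq n (Cross (odd m) c)) ends4 = Some ends4.
Proof.
move=> /even_halfK <-; elim: n./2 => // k IHk.
by rewrite doubleS -[RHS]IHk /ends4; case: (odd m).
Qed.

(** The right closure is left off because the induction compares both closures. *)
Definition open_bridge bs : diagram :=
  [:: Open 0 true; Open 2 true] ++ braids true bs.

(* For [b = b_m], the number of crossings of the m-th braid counted with sign. *)
Definition signed_coef m (b : int) : int := (-1) ^+ m.+1 * b.

Lemma braids_rcons e bs b :
  braids e (rcons bs b) = braids e bs ++
    (if e (+) odd (size bs) then braid 1 (- b) else braid 0 b).
Proof.
elim: bs e => [|b' bs IHbs] e /=; first by rewrite addbF cats0.
by rewrite IHbs catA addNb addbN.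
Qed.

(** Neighbouring strands of [ends4] are antiparallel, so [Cross _ true] is a negative crossing;
    hence the test [signed_coef m b < 0]. *)
Lemma open_bridge_rcons bs b (m := (size bs).+1) :
  open_bridge (rcons bs b)
    = open_bridge bs ++ nseq `|b| (Cross (odd m) (signed_coef m b < 0)).
Proof.
rewrite /open_bridge braids_rcons catA; congr (_ ++ _).
rewrite /braid /signed_coef -signr_odd /= negbK.
by case: (odd _);
  rewrite /= ?expr0 ?expr1 ?mul1r ?mulN1r ?oppr_gt0 ?oppr_lt0 ?abszN.
Qed.

Lemma run_open_bridge bs :
  even_continued_fraction bs -> run (open_bridge bs) [::] = Some ends4.
Proof.
elim/last_ind: bs => // bs b IHbs; rewrite /even_continued_fraction all_rcons.
case/andP=> /andP[_ even_b] /IHbs run_bs.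
rewrite open_bridge_rcons run_cat run_bs; apply: run_braid.
by move: even_b; rewrite dvdzE dvdn2.
Qed.

(** * Jones polynomials of closed braids *)

Section Jones.

Variable V : diagram -> ratfun.
Hypothesis jonesV : is_jones V.

Lemma jones_move u v x y s :
    run u [::] = Some s -> run x s = run y s -> local_move x y ->
  is_link (u ++ y ++ v) -> V (u ++ x ++ v) = V (u ++ y ++ v).
Proof.
move=> u_s xy_s xy link_y; apply: (jones_isotopy jonesV).
apply: isotopic_move xy => //.
by rewrite /is_link (run_congr _ v _ _ _ _ u_s xy_s).
Qed.

Lemma jones_Cross_Close u v i c n s :
    run u [::] = Some s -> (i.+1 < size s)%N -> is_link (u ++ Close i :: v) ->
  V (u ++ nseq n (Cross i c) ++ Close i :: v) = V (u ++ Close i :: v).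
Proof.
elim: n u s => //= n IHn u s u_s /section_split[s1 [a [b [s2 [def_s def_i]]]]].
subst i s => link_u.
have eq_run : run [:: Cross (size s1) c; Close (size s1)] (s1 ++ [:: a, b & s2])
            = run [:: Close (size s1)] (s1 ++ [:: a, b & s2]).
  by rewrite !run_cons act_Cross /= -/(act (Close _) _) run_cons !act_Close eq_sym.
have u'_s : run (rcons u (Cross (size s1) c)) [::] = Some (s1 ++ [:: b, a & s2]).
  by rewrite -cats1 run_cat u_s /= run_cons act_Cross.
(* The first crossing joins [u], the induction hypothesis erases the others, and one R1 move erases
   it. *)
rewrite -cat_rcons (IHn _ _ u'_s) ?cat_rcons.
- exact: (jones_move u v _ _ _ u_s eq_run (move_R1_close _ _)).
- by rewrite size_cat -addn2 leq_add2l.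
by rewrite /is_link (run_congr _ v _ _ _ _ u_s eq_run).
Qed.

(** Each crossing absorbed by the arc reverses its orientation, whence [o (+) odd n]. *)
Lemma jones_Open_Cross u v i o c n s :
    run u [::] = Some s -> (i <= size s)%N ->
    is_link (u ++ Open i (o (+) odd n) :: v) ->
  V (u ++ Open i o :: nseq n (Cross i c) ++ v)
    = V (u ++ Open i (o (+) odd n) :: v).
Proof.
move=> u_s le_is.
have [s1 [s2 [def_s def_i]]] : exists s1 s2, s = s1 ++ s2 /\ size s1 = i.
  by exists (take i s), (drop i s); rewrite cat_take_drop size_takel.
subst i s; set i := size s1 in le_is *; set s := s1 ++ s2 in u_s le_is.
have eq1 o' : run [:: Open i o'; Cross i c] s = run [:: Open i (~~ o')] s.
  by rewrite !run_cons !act_Open /= run_cons act_Cross negbK.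
have eq_n k o' : run (Open i o' :: nseq k (Cross i c)) s
    = run [:: Open i (o' (+) odd k)] s.
  elim: k o' => [|k IHk] o' /=; first by rewrite addbF.
  rewrite addbN -addNb -IHk.
  by rewrite (run_cat [:: _; _] (nseq _ _)) eq1 -run_cat.
elim: n o => [|n IHn] o /=; first by rewrite addbF.
rewrite addbN -addNb => link_u; rewrite -IHn //.
apply: (jones_move u _ _ _ _ u_s (eq1 o) (move_R1_open _ _ _)).
exact: (etrans (run_congr u v _ _ _ _ u_s (eq_n n (~~ o))) link_u).
Qed.

(** [right_closure m.+1] begins with an arc joining the two strands of the [m]-th braid, which
    therefore untwists. *)
Lemma jones_erase_braid P m n c : run P [::] = Some ends4 ->
  V (P ++ nseq n (Cross (odd m) c) ++ right_closure m.+1)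
    = V (P ++ right_closure m.+1).
Proof.
move=> P_ends; have def_rc : right_closure m.+1 = Close (odd m) :: [:: Close 0].
  by rewrite /right_closure /=; case: (odd m).
rewrite def_rc (jones_Cross_Close _ _ _ _ _ _ P_ends) //; first by case: (odd m).
by rewrite /is_link run_cat P_ends; case: (odd m).
Qed.

(** The crossings untwist from the arc opened by the smoothing; this arc and the first arc of
    [right_closure m] then form a zigzag, and straightening it leaves the other closure. *)
Lemma jones_smoothing P m n c : run P [::] = Some ends4 -> odd n ->
  V (P ++ [:: Close (odd m); Open (odd m) (nth true ends4 (odd m).+1)]
       ++ nseq n (Cross (odd m) c) ++ right_closure m)
    = V (P ++ right_closure m.+1).
Proof.
move=> P_ends odd_n.
have u_s : run (P ++ [:: Close (odd m)]) [::] = Some [:: true; false].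
  by rewrite run_cat P_ends /=; case: (odd m).
rewrite -[LHS]/(V (P ++ [:: Close _] ++ Open _ _ :: _)) catA.
rewrite (jones_Open_Cross _ _ _ _ _ _ _ u_s) ?odd_n ?addbT.
- rewrite /right_closure /=; case: (odd m) in u_s * => /=.
    rewrite (jones_move _ [:: Close 0] [:: Open 1 false; Close 0] [::] _ u_s) //.
    + by rewrite -catA.
    + exact: move_zagzig.
    by rewrite /is_link run_cat u_s.
  rewrite (jones_move _ [:: Close 0] [:: Open 0 true; Close 1] [::] _ u_s) //.
  + by rewrite -catA.
  + exact: move_zigzag.
  by rewrite /is_link run_cat u_s.
- by case: (odd m).
by rewrite /is_link run_cat u_s /right_closure; case: (odd m).
Qed.

(** Changing one of [n.+1.*2] crossings cancels it against its neighbour and leaves [n.*2];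
    smoothing it leaves an odd number, which [jones_smoothing] erases. *)
Lemma jones_braid P m n c : run P [::] = Some ends4 ->
    let W k := V (P ++ nseq k.*2 (Cross (odd m) c) ++ right_closure m) in
    let X := V (P ++ right_closure m.+1) in
  W n.+1 = if c then t ^- 2 * W n + t^-1 * (sqrt_t^-1 - sqrt_t) * X
           else t ^+ 2 * W n - t * (sqrt_t^-1 - sqrt_t) * X.
Proof.
move=> P_ends W X.
pose B := nseq n.*2.+1 (Cross (odd m) c) ++ right_closure m.
have link_P : is_link (P ++ nseq n.*2 (Cross (odd m) c) ++ right_closure m).
  rewrite /is_link run_cat P_ends /= run_cat run_braid ?odd_double //=.
  by rewrite /right_closure; case: (odd m).
have R2 : V (P ++ Cross (odd m) (~~ c) :: B) = W n.
  apply: (jones_move _ _ [:: _; _] [::] _ P_ends) => //; first by case: (odd m).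
  by have := move_R2 (odd m) (~~ c); rewrite negbK.
have skein : t^-1 * V (P ++ Cross (odd m) false :: B)
             - t * V (P ++ Cross (odd m) true :: B) + (sqrt_t^-1 - sqrt_t) * X = 0.
  rewrite /X -(jones_smoothing _ _ n.*2.+1 c P_ends) /= ?odd_double //.
  apply: (jones_skein jonesV).
  apply: (@skein_antiparallel P B (odd m) ends4); rewrite ?P_ends //;
    last by case: (odd m).
  rewrite /is_link run_cat P_ends /=.
  rewrite -[LHS]/(run (nseq n.+1.*2 (Cross (odd m) c) ++ right_closure m) ends4).
  rewrite run_cat run_braid ?odd_double //.
  by rewrite /right_closure; case: (odd m).
have t0 := sqrt_t_neq0.
have eqW : V (P ++ Cross (odd m) c :: B) = W n.+1 by [].
move: (W n) (W n.+1) B R2 eqW skein => W0 W1 B R2 eqW; clear W link_P.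
by case: c R2 eqW => -> ->; case/(skein_solve _ _ _ _ _ sqrt_t_neq0).
Qed.

Lemma jones_braid_closed P m n c : run P [::] = Some ends4 ->
    let T := (if c then t ^- 2 else t ^+ 2) ^+ n in
  V (P ++ nseq n.*2 (Cross (odd m) c) ++ right_closure m)
    = T * V (P ++ right_closure m)
      + (1 - T) * limit_coef * V (P ++ right_closure m.+1).
Proof.
move=> P_ends /=; elim: n => [|n IHn]; first by rewrite /= expr0 subrr; ring.
rewrite jones_braid // {}IHn.
rewrite [_ ^+ n.+1]exprS.
exact: (braid_recursion ratfun c sqrt_t _ _ _ sqrt_t_neq0 addt_neq0).
Qed.

(** This two-component unlink is the smoothing of a one-crossing unknot diagram, whose crossing
    change is again an unknot. *)
Lemma jones_open_bridge1 :
  V (open_bridge [::] ++ right_closure 1) = - (sqrt_t + sqrt_t^-1).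
Proof.
have flip c : V [:: Open 0 true; Cross 0 c; Close 0] = 1.
  rewrite -(jones_unknot jonesV).
  exact: (jones_move [:: Open 0 true] [::] _ _ _ erefl _ (move_R1_close 0 c)).
have slide : V [:: Open 0 true; Close 0; Open 0 true; Close 0]
           = V [:: Open 0 true; Open 2 true; Close 0; Close 0].
  apply: (jones_move [:: Open 0 true] [:: Close 0] [:: Close 0; Open 0 true]
    [:: Open 2 true; Close 0] _ erefl) => //.
  exact: (@move_slide (Close 0) (Open 0 true) 0).
(* The smoothing orients the second circle the other way; a kink inserted at its closing arc and
   absorbed at its opening arc reverses it. *)
have reverse : V [:: Open 0 true; Close 0; Open 0 false; Close 0]
             = V [:: Open 0 true; Close 0; Open 0 true; Close 0].
  rewrite -[RHS](jones_move [:: Open 0 true; Close 0; Open 0 true] [::]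
    [:: Cross 0 true; Close 0] [:: Close 0] _ erefl) //; last exact: move_R1_close.
  rewrite -(jones_move [:: Open 0 true; Close 0] [:: Close 0]
    [:: Open 0 true; Cross 0 true] [:: Open 0 false] _ erefl) //.
  exact: (move_R1_open 0 true true).
have := jones_skein jonesV (@skein_antiparallel [:: Open 0 true] [:: Close 0] 0 _
  erefl erefl (fun e => ltac:(discriminate e))).
rewrite /= !flip reverse slide.
exact: (skein_unlink _ _ _ sqrt_t_neq0 subt_neq0).
Qed.

Lemma jones_open_bridge0 : V (open_bridge [::] ++ right_closure 0) = 1.
Proof.
rewrite -(jones_unknot jonesV).
exact: (jones_move [:: Open 0 true] [:: Close 0] _ _ _ erefl _ (move_zagzig 1 true)).
Qed.

End Jones.

(** * Leading terms of rational functions *)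

(* The degree is counted in powers of [t^(1/2)]. Quotients are allowed here because
   of [limit_coef], which is not a Laurent polynomial. *)
Definition lead (f : ratfun) (d k : int) : Prop :=
  exists p q : {poly int}, [/\ q \is monic, p != 0, f = tofrac p / tofrac q,
    d = (size p)%:Z - (size q)%:Z & k = lead_coef p].

Lemma lead_poly (p : {poly int}) :
  p != 0 -> lead (tofrac p) ((size p)%:Z - 1) (lead_coef p).
Proof.
by move=> p0; exists p, 1; rewrite monic1 rmorph1 divr1 size_poly1.
Qed.

Lemma tofrac_neq0 (p : {poly int}) : p != 0 -> tofrac p != 0.
Proof. by rewrite tofrac_eq0. Qed.

Lemma lead_mul f g d e k l :
  lead f d k -> lead g e l -> lead (f * g) (d + e) (k * l).
Proof.
case=> [p [q [mq p0 -> -> ->]]] [p' [q' [mq' p'0 -> -> ->]]].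
exists (p * p'), (q * q'); split.
- by rewrite monicMl.
- exact: mulf_neq0.
- by rewrite mulf_div !rmorphM.
- rewrite !size_mul ?(monic_neq0 mq, monic_neq0 mq') //.
  move: p0 p'0 (monic_neq0 mq) (monic_neq0 mq'); rewrite -!size_poly_gt0.
  by move: (size p) (size q) (size p') (size q'); lia.
- by rewrite lead_coefM.
Qed.

Lemma lead_opp f d k : lead f d k -> lead (- f) d (- k).
Proof.
case=> [p [q [mq p0 -> -> ->]]]; exists (- p), q.
by rewrite oppr_eq0 rmorphN mulNr size_polyN lead_coefN.
Qed.

Lemma lead_add f g d e k l :
  lead f d k -> lead g e l -> e < d -> lead (f + g) d k.
Proof.
case=> [p [q [mq p0 -> -> ->]]] [p' [q' [mq' p'0 -> -> _]]] lt_ed.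
have lt_size : (size (p' * q)%R < size (p * q')%R)%N.
  rewrite !size_mul ?(monic_neq0 mq, monic_neq0 mq') //.
  move: p0 p'0 (monic_neq0 mq) (monic_neq0 mq') lt_ed; rewrite -!size_poly_gt0.
  by move: (size p) (size q) (size p') (size q'); lia.
exists (p * q' + p' * q), (q * q'); split.
- by rewrite monicMl.
- by rewrite -size_poly_gt0 size_polyDl // (leq_ltn_trans _ lt_size).
- by rewrite rmorphD !rmorphM addf_div
    ?tofrac_neq0 ?(monic_neq0 mq, monic_neq0 mq') // mulrC.
- rewrite size_polyDl // !size_mul ?(monic_neq0 mq, monic_neq0 mq') //.
  move: p0 (monic_neq0 mq) (monic_neq0 mq'); rewrite -!size_poly_gt0.
  by move: (size p) (size q) (size q'); lia.
- by rewrite lead_coefDl // lead_coefM (monicP mq') mulr1.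
Qed.

Lemma lead1 : lead 1 0 1.
Proof. by exists 1, 1; rewrite monic1 oner_eq0 divr1 rmorph1 lead_coef1 subrr. Qed.

Lemma lead_inv f d : lead f d 1 -> lead f^-1 (- d) 1.
Proof.
case=> [p [q [mq p0 -> -> lp]]]; exists q, p; split.
- by rewrite monicE -lp.
- exact: monic_neq0.
- by rewrite invf_div.
- by rewrite opprB.
- by rewrite (monicP mq).
Qed.

Lemma lead_exp f d n : lead f d 1 -> lead (f ^+ n) (d *+ n) 1.
Proof.
move=> lead_f; elim: n => [|n IHn]; first by rewrite expr0; exact: lead1.
by rewrite exprS mulrS -[1]mulr1; apply: lead_mul.
Qed.

Lemma lead_sqrt_t : lead sqrt_t 1 1.
Proof.
by have := lead_poly _ (monic_neq0 (monicX _)); rewrite size_polyX lead_coefX.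
Qed.

Lemma lead_t : lead t 2 1.
Proof. exact: (lead_exp _ _ 2 lead_sqrt_t). Qed.

Lemma lead_limit_coef : lead limit_coef (- 1) (- 1).
Proof.
have lead_t1 : lead (1 + t) 2 1.
  by rewrite addrC; apply: lead_add lead_t lead1 _.
have lead_s := lead_opp _ _ _ lead_sqrt_t.
exact: (lead_mul _ _ _ _ _ _ lead_s (lead_inv _ _ lead_t1)).
Qed.

Lemma lead_laurent f d k :
  is_laurent f -> lead f d k -> has_leading_term f (d%:~R / 2) k.
Proof.
case=> p [n def_f] [p' [q [mq p'0 def_f' -> ->]]].
(* Both denominators are monic, so cross-multiplication carries the degree and the leading
   coefficient over to [p]. *)
have eq_pq : p * q = p' * 'X^n.
  have s0 : sqrt_t ^+ n != 0 by rewrite expf_neq0 ?sqrt_t_neq0.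
  have q0 := tofrac_neq0 _ (monic_neq0 mq).
  have /eqP := etrans (esym def_f) def_f'; rewrite (eqr_div _ _ s0 q0) /sqrt_t.
  by rewrite -rmorphXn -!rmorphM tofrac_eq => /eqP.
have p0 : p != 0.
  apply: contraTneq (mulf_neq0 p'0 (monic_neq0 (monicXn int n))) => p0.
  by rewrite -eq_pq p0 mul0r eqxx.
exists p, n; split=> //.
  congr (_ / 2); have := congr1 (fun r : {poly int} => size r) eq_pq.
  rewrite !size_mul ?(monic_neq0 mq) ?(monic_neq0 (monicXn _ _)) // size_polyXn.
  move: p0 p'0 (monic_neq0 mq); rewrite -!size_poly_gt0 !pmulrn -intrB.
  move: (size p) (size q) (size p') => a b c; move=> *; congr (_%:~R); lia.
have := congr1 lead_coef eq_pq.
by rewrite !lead_coefM (monicP mq) lead_coefXn !mulr1.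
Qed.

(** * Appending a coefficient to the continued fraction *)

Lemma count_plus_plus_rcons s x :
  count_plus_plus (rcons s x)
    = (count_plus_plus s + ((last 0%R s == 1%R) && (x == 1%R)))%N.
Proof.
(* For empty [s], the default [0] of [last] is not a [+]. *)
rewrite /count_plus_plus; case: s => [|y s] /=; first by [].
elim: s y => [|z s IHs] y /=; first by rewrite addn0.
by rewrite IHs addnA.
Qed.

Lemma count_plus_plus_le s : (count_plus_plus s <= size s)%N.
Proof. by apply: leq_trans (count_size _ _) _; rewrite size_zip geq_minl. Qed.

Lemma coef_at_rcons bs b i :
  coef_at (rcons bs b) i = if (i <= size bs)%N then coef_at bs i
                           else if i == (size bs).+1 then b else 0.
Proof. by rewrite /coef_at -rcons_cons nth_rcons /= ltnS; case: ltngtP. Qed.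

Lemma type_sequence_rcons bs b :
  type_sequence (rcons bs b)
    = rcons (type_sequence bs) (sgz (signed_coef (size bs).+1 b)).
Proof.
rewrite /type_sequence size_rcons -[(size bs).+1]addn1 iotaD map_cat cats1 addn1.
congr rcons.
  apply/eq_in_map => i; rewrite mem_iota => /andP[_ lt_i].
  by rewrite coef_at_rcons -ltnS -add1n lt_i.
rewrite add1n coef_at_rcons ltnn eqxx /signed_coef sgzM; congr (_ * _).
by rewrite -signr_odd; case: odd.
Qed.

Lemma jones_degree_rcons bs b :
  jones_degree (rcons bs b) = jones_degree bs +
    Num.max ((-1) ^+ (size bs).+2 * b%:~R
               + (sgz (b * coef_at bs (size bs)))%:~R / 2) (- (1 / 2)).
Proof.
rewrite /jones_degree size_rcons big_nat_recr //=; congr (_ + _).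
  apply: eq_big_nat => i /andP[i_gt0 lt_i].
  rewrite !coef_at_rcons; rewrite ltnS in lt_i; rewrite lt_i.
  by rewrite (leq_trans (leq_pred i) lt_i).
by rewrite !coef_at_rcons leqnn ltnn eqxx.
Qed.

(** Closing with the parity of the length gives V_m, with the other parity V_(m-1); a new
    coefficient shifts this pair. [T] is [t] to the power [signed_coef m b]. *)
Lemma jones_open_bridge_rcons V bs b (m := (size bs).+1) (c := signed_coef m b < 0)
    (T := (if c then t ^- 2 else t ^+ 2) ^+ `|b|./2) :
    is_jones V -> even_continued_fraction bs -> ~~ odd `|b| ->
  V (open_bridge (rcons bs b) ++ right_closure m)
      = T * V (open_bridge bs ++ right_closure m)
        + (1 - T) * limit_coef * V (open_bridge bs ++ right_closure (size bs))
  /\ V (open_bridge (rcons bs b) ++ right_closure m.+1)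
      = V (open_bridge bs ++ right_closure (size bs)).
Proof.
move=> jonesV even_bs even_b; have run_bs := run_open_bridge _ even_bs.
have rcSS : right_closure m.+1 = right_closure (size bs).
  by rewrite /right_closure /= negbK.
rewrite open_bridge_rcons -!catA -rcSS -/m -/c; split.
  by have := jones_braid_closed V jonesV _ m `|b|./2 c run_bs; rewrite even_halfK.
exact: (jones_erase_braid V jonesV _ m _ c run_bs).
Qed.

(** For empty [bs], the convention b_0 = 1 gives [signed_coef 0 1 = -1], in agreement with the
    default [0] of [last] falling in the [-] case. *)
Lemma sgz_last bs : even_continued_fraction bs ->
  sgz (signed_coef (size bs) (coef_at bs (size bs)))
    = if last 0 (type_sequence bs) == 1 then 1 else -1.
Proof.
elim/last_ind: bs => [|bs b _]; first by [].
rewrite /even_continued_fraction all_rcons => /andP[/andP[b0 _] _].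
rewrite type_sequence_rcons last_rcons size_rcons coef_at_rcons ltnn eqxx.
have : signed_coef (size bs).+1 b != 0 by rewrite mulf_eq0 signr_eq0.
by case: sgzP.
Qed.

Lemma degree_summand bs b (m := (size bs).+1) (n := `|b|./2) :
    even_continued_fraction bs -> b != 0 -> ~~ odd `|b| ->
  Num.max ((-1) ^+ m.+1 * b%:~R + (sgz (b * coef_at bs (size bs)))%:~R / 2)
          (- (1 / 2))
    = (if signed_coef m b < 0 then -1
       else if last 0 (type_sequence bs) == 1 then (4 * n)%:Z - 1
       else (4 * n)%:Z + 1)%:~R / 2 :> rat.
Proof.
move=> even_bs b0 even_b; have := sgz_last _ even_bs; rewrite {even_bs}.
set b' := coef_at _ _; set plus := last 0 _ == 1 => sgz_b'.
set a := signed_coef m b.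
have -> : (-1) ^+ m.+1 * b%:~R = a%:~R :> rat.
  by rewrite /a /signed_coef rmorphM rmorphXn rmorphN1.
(* Types alternate the signs, so consecutive coefficients have equal signs iff their types
   differ. *)
have -> : sgz (b * b') = - (sgz a * (if plus then 1 else -1)).
  rewrite -sgz_b' /a /signed_coef -(signr_odd _ m.+1) -(signr_odd _ (size bs).+1) /=.
  by case: (odd _); rewrite /= ?expr0 ?expr1 !(sgzM, sgzN, sgz1); ring.
have def_a : a = if a < 0 then - (2 * n)%:Z else (2 * n)%:Z.
  have : `|a|%N = n.*2 by rewrite abszM abszX exp1n mul1n even_halfK.
  by rewrite -mul2n; case: ltP; lia.
(* This bound decides the maximum: -2n ± 1/2 is at most -1/2, and 2n ± 1/2 exceeds it. *)
have n_ge1 : 1 <= n%:R :> rat.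
  by rewrite ler1n; move: even_b b0; rewrite /n -absz_gt0; case: `|b|%N => [|[]].
case: ltP def_a => _ ->.
  rewrite (_ : sgz _ = -1); last lia.
  rewrite !mulrNz -pmulrn natrM; apply/eqP.
  by case: (plus); rewrite max_r ?mulr1 ?mulrN1 ?mulrNz //; lra.
rewrite (_ : sgz _ = 1); last lia.
rewrite mul1r -pmulrn natrM.
by case: (plus); rewrite ?opprK ?mulrNz ?intrD -?pmulrn ?natrM max_l; lra.
Qed.

(** Degrees of V_m and V_(m-1) are in powers of [sqrt_t], so the gaps [d - d'] are doubled: at least
    3, or exactly -1. *)
Lemma lead_two_bridge V bs : is_jones V -> even_continued_fraction bs ->
  exists d d' k k' : int,
    [/\ lead (V (open_bridge bs ++ right_closure (size bs))) d k,
        lead (V (open_bridge bs ++ right_closure (size bs).+1)) d' k',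
        d%:~R / 2 = jones_degree bs,
        sgz k = (-1) ^+ (size bs + count_plus_plus (type_sequence bs)) &
        if last 0 (type_sequence bs) == 1 then d' + 3 <= d
        else (d' == d + 1) && (sgz k' == - sgz k)].
Proof.
move=> jonesV; elim/last_ind: bs => [_|bs b IHbs].
  exists 0, 1, 1, (-1); rewrite (jones_open_bridge0 _ jonesV) (jones_open_bridge1 _ jonesV).
  split=> //.
  - exact: lead1.
  - by apply: lead_opp; apply: lead_add lead_sqrt_t (lead_inv _ _ lead_sqrt_t) _.
  by rewrite /jones_degree big_geq // mul0r.
rewrite /even_continued_fraction all_rcons => /andP[/andP[b0 even_b] even_bs].
have {}even_b : ~~ odd `|b| by move: even_b; rewrite dvdzE dvdn2.
have [d [d' [k [k' [leadX leadY deg_d sgz_k prev]]]]] := IHbs even_bs.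
have n_gt0 : (0 < `|b|./2)%N.
  by move: even_b b0; rewrite -absz_gt0; case: `|b|%N => [|[]].
rewrite size_rcons jones_degree_rcons degree_summand // -{}deg_d.
rewrite type_sequence_rcons last_rcons count_plus_plus_rcons.
have [-> ->] := jones_open_bridge_rcons V bs b jonesV even_bs even_b.
set c := signed_coef _ _ < 0; set T := _ ^+ _.
have lead_T : lead T (if c then - (4 * `|b|./2)%:Z else (4 * `|b|./2)%:Z) 1.
  have -> : (if c then - (4 * `|b|./2)%:Z else (4 * `|b|./2)%:Z)
          = (if c then - (2 *+ 2) else 2 *+ 2) *+ `|b|./2.
    by rewrite pmulrn mulrzz; case: (c); lia.
  have lead_t2 := lead_exp _ _ 2 lead_t.
  by apply: lead_exp; case: (c) => //; exact: lead_inv.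
have -> : (sgz (signed_coef (size bs).+1 b) == 1) = ~~ c.
  have : signed_coef (size bs).+1 b != 0 by rewrite mulf_eq0 signr_eq0.
  by rewrite /c; case: sgzP.
clearbody c T.
set n := `|b|./2 in n_gt0 lead_T *.
case: c lead_T => lead_T.
  have lead_1T : lead (1 - T) 0 1.
    apply: lead_add lead1 (lead_opp _ _ _ lead_T) _; lia.
  (* Here [1 - T] leads with 1 and [limit_coef] contributes degree -1 and sign -1; the other term
     has degree at most [d + 1 - 4 * n], which is below [d - 1]. *)
  exists (d - 1), d, (- k), k; split=> //.
  - rewrite addrC.
    have leadP := lead_mul _ _ _ _ _ _
      (lead_mul _ _ _ _ _ _ lead_1T lead_limit_coef) leadX.
    have := lead_add _ _ _ _ _ _ leadP (lead_mul _ _ _ _ _ _ lead_T leadY).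
    rewrite add0r mul1r mulN1r [-1 + d]addrC; apply.
    case: eqP prev => _; lia.
  - by rewrite intrD mulrDl.
  - by rewrite sgzN sgz_k andbF addn0 addSn exprS mulN1r.
  by rewrite subrK sgzN opprK !eqxx.
have lead_1T : lead (1 - T) (4 * n)%:Z (- 1).
  rewrite addrC; apply: lead_add (lead_opp _ _ _ lead_T) lead1 _; lia.
have leadP := lead_mul _ _ _ _ _ _
  (lead_mul _ _ _ _ _ _ lead_1T lead_limit_coef) leadX.
have leadTY := lead_mul _ _ _ _ _ _ lead_T leadY.
case: eqP prev => [plus | minus] prev.
  (* After a [+], the [limit_coef] term dominates and its two minus signs cancel; the sign is kept,
     as the length and the count of [+,+] both grow by one. *)
  exists (d + ((4 * n)%:Z - 1)), d, k, k; split=> //.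
  - have := lead_add _ _ _ _ _ _ leadP leadTY.
    rewrite mulrNN !mul1r [_ + d]addrC [T * _ + _]addrC; apply; lia.
  - by rewrite intrD mulrDl.
  - rewrite sgz_k addn1 addSnnS [in RHS]addnS [in RHS]addnS !exprS.
    by rewrite mulrA mulrNN !mul1r.
  by rewrite /=; lia.
case/andP: prev => /eqP def_d' /eqP sgz_k'.
(* After a [-], the [T] term dominates because [d' = d + 1]; [k'] has the sign opposite to [k], as
   the length grows alone. *)
exists (d + ((4 * n)%:Z + 1)), d, k', k; split=> //.
- have := lead_add _ _ _ _ _ _ leadTY leadP.
  rewrite mul1r def_d' addrCA; apply; lia.
- by rewrite intrD mulrDl.
- by rewrite sgz_k' sgz_k addn0 addSn exprS mulN1r.
by rewrite /=; lia.
Qed.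

Theorem theorem5p9 (V : diagram -> ratfun) (bs : seq int) :
  is_jones V ->
  bs != [::] ->
  even_continued_fraction bs ->
  exists c : int,
    has_leading_term (V (two_bridge bs)) (jones_degree bs) c /\
    sgz c = (-1) ^+ (size bs - count_plus_plus (type_sequence bs))%N.
Proof.
move=> jonesV _ even_bs.
have [d [_ [k [_ [leadV _ <- sgz_k _]]]]] := lead_two_bridge V bs jonesV even_bs.
exists k; split.
  rewrite /two_bridge catA; apply: lead_laurent leadV.
  apply: (jones_laurent jonesV); rewrite /is_link run_cat (run_open_bridge _ even_bs).
  by rewrite /right_closure; case: odd.
(* With this bound the truncated difference is genuine and has the parity of the sum. *)
have le_count : (count_plus_plus (type_sequence bs) <= size bs)%N.
  by rewrite (leq_trans (count_plus_plus_le _)) // size_map size_iota.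
by rewrite sgz_k -signr_odd oddD -oddB // signr_odd.
Qed.
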